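(* Write $\dfrac{(q;q)_\infty^9}{(q^3;q^3)_\infty^9}=\sum_{n\ge0}a_nq^n$. Then for all $n\ge0$: $a_n>0$ if $n\equiv0,2,5,8\pmod9$; $a_n<0$ if $n\equiv1,3,4,7\pmod9$; and $a_n=0$ if $n\equiv 6\pmod 9$.
   Context: For $|q|<1$, $(a;q)_\infty=\prod_{k\ge0}(1-aq^k)$. *)

(* Defs.v *)
From mathcomp Require Import all_boot all_order all_algebra.
Set Implicit Arguments. Unset Strict Implicit. Unset Printing Implicit Defensive.
Import Order.TTheory GRing.Theory Num.Theory.
Local Open Scope ring_scope.

(* Formal q-series over int, computed exactly up to degree n.
   (q;q)_oo = \prod_{k>=0} (1 - q^{k+1}) = \prod_{k>=1} (1 - q^k). *)

(* truncation of (q;q)_oo: factors with k <= N (the others are 1 mod q^{N+1}) *)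
Definition qpoch_q (N : nat) : {poly int} :=
  \prod_(1 <= k < N.+1) (1 - 'X^k).

(* truncation of 1/(q^3;q^3)_oo = \prod_{k>=1} \sum_{j>=0} q^{3kj}, exact mod q^{N+1} *)
Definition inv_qpoch_q3 (N : nat) : {poly int} :=
  \prod_(1 <= k < N.+1) \sum_(j < N.+1) 'X^(3 * k * j).

Definition a (n : nat) : int :=
  ((qpoch_q n ^+ 9) * (inv_qpoch_q3 n ^+ 9))`_n.

(* Main.v *)
(* Write E_k for (q^k; q^k)_oo. Splitting the indices in Jacobi's identity
   E_1^3 = sum_j (-1)^j (2 j + 1) q^(j (j + 1) / 2) modulo 3 gives
     E_1^3 = P(q^3) - 3 q E_9^3,
   where P = E_1 a(q) and
     a(q) = 1 + 6 sum_k (q^(3k+1) / (1 - q^(3k+1)) - q^(3k+2) / (1 - q^(3k+2)))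
   by differentiating the triple product at z = 1. Multiplying the three
   conjugates q -> w q (w a primitive cube root of unity) of the first identity
   gives P(q^3)^3 - 27 q^3 E_9^9 = E_3^12 / E_9^3. Hence E_1^9 / E_3^9 =
     E_3^3 / E_9^3 - 9 q (P^2 E_3^3 / E_1^9)(q^3) + 27 q^2 (P E_3^6 / E_1^9)(q^3),
   and the first identity at q^3 splits the first summand again as
     (P / E_1^3)(q^9) - 3 q^3 (E_3^3 / E_1^3)(q^9).
   Everything is now a product of 1 / E_1, E_3 / E_1 and a / E_1, which have
   positive coefficients; for a / E_1, combine the two terms of index k into
   q^(3k+1) (1 - q) / ((1 - q^(3k+1)) (1 - q^(3k+2))) and cancel 1 - q.
   Modulo q^(n+1) a power series becomes a function of a nilpotent element of a
   commutative ring, here the class of X in algC[X] / (X^(n+1)). *)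
Require Import Defs.
From mathcomp Require Import all_boot all_order all_algebra all_field.
From mathcomp Require Import zify ring.
Set Implicit Arguments. Unset Strict Implicit. Unset Printing Implicit Defensive.
Import Order.TTheory GRing.Theory Num.Theory.
Local Open Scope ring_scope.

(** * Gaussian binomials and the finite Jacobi triple product *)

Definition epoch (A : comNzRingType) (x : A) (m : nat) : A :=
  \prod_(k < m) (1 - x ^+ k.+1).

(** The Gaussian binomial, given by the q-Pascal rule so that it needs no division and exists in
    every commutative ring. *)
Fixpoint qbin (A : comNzRingType) (x : A) (m j : nat) : A :=
  match m, j with
  | _, 0 => 1
  | 0, _.+1 => 0
  | m'.+1, j'.+1 => qbin x m' j' + x ^+ j'.+1 * qbin x m' j'.+1
  end.

Lemma epochS (A : comNzRingType) (x : A) m :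
  epoch x m.+1 = epoch x m * (1 - x ^+ m.+1).
Proof. by rewrite /epoch big_ord_recr. Qed.

Lemma qbinS (A : comNzRingType) (x : A) m j :
  qbin x m.+1 j.+1 = qbin x m j + x ^+ j.+1 * qbin x m j.+1.
Proof. by []. Qed.

Lemma qbin0 (A : comNzRingType) (x : A) m : qbin x m 0 = 1.
Proof. by case: m. Qed.

Lemma qbin_gt (A : comNzRingType) (x : A) m j : (m < j)%N -> qbin x m j = 0.
Proof.
elim: m j => [|m IH] [|j] //= lt_mj.
by rewrite !IH ?mulr0 ?addr0 // ltnW.
Qed.

(** The mirror q-Pascal rule: expand by [qbinS], apply induction to both terms and regroup. *)
Lemma qbinSr (A : comNzRingType) (x : A) m j : (j <= m)%N ->
  qbin x m.+1 j.+1 = x ^+ (m - j) * qbin x m j + qbin x m j.+1.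
Proof.
elim: m j => [|m IH] [|j] le_jm //.
- by rewrite /= !mulr0 addr0 mulr1 addr0.
- by rewrite [LHS]qbinS [in LHS]IH // qbinS !qbin0 !subn0 !exprS; ring.
have [eq_jm|neq_jm] := eqVneq j m.
  rewrite eq_jm subnn expr0 mul1r qbinS !(@qbin_gt _ _ m.+1 m.+2) //.
  by rewrite mulr0.
rewrite [LHS]qbinS [in LHS]IH // [in LHS]IH; last by lia.
rewrite [qbin x m.+1 j.+1]qbinS [qbin x m.+1 j.+2]qbinS.
have -> : (m.+1 - j.+1 = (m - j.+1).+1)%N by lia.
have -> : (m - j = (m - j.+1).+1)%N by lia.
by rewrite !exprS; ring.
Qed.

Lemma qbinn (A : comNzRingType) (x : A) m : qbin x m m = 1.
Proof. by elim: m => //= m IH; rewrite IH qbin_gt // mulr0 addr0. Qed.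

Lemma epoch0 (A : comNzRingType) (x : A) : epoch x 0 = 1.
Proof. by rewrite /epoch big_ord0. Qed.

Lemma qbin_epoch (A : comNzRingType) (x : A) i j :
  qbin x (i + j) i * epoch x i * epoch x j = epoch x (i + j).
Proof.
move: {2}(i + j)%N (leqnn (i + j)) => m; elim: m i j => [|m IH] [|i] [|j] //;
  rewrite ?addn0 ?add0n ?qbin0 ?qbinn ?epoch0 ?mul1r ?mulr1 // => le_m.
rewrite addSn qbinS epochS.
have -> : epoch x (i + j.+1).+1 = epoch x (i + j.+1) * (1 - x ^+ (i.+1 + j.+1)).
  by rewrite epochS.
have H1 := IH i j.+1 ltac:(lia).
have H2 := IH i.+1 j ltac:(lia).
rewrite addSnnS in H2.
have -> : (qbin x (i + j.+1) i + x ^+ i.+1 * qbin x (i + j.+1) i.+1) *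
  (epoch x i * (1 - x ^+ i.+1)) * epoch x j.+1 =
  (qbin x (i + j.+1) i * epoch x i * epoch x j.+1) * (1 - x ^+ i.+1) +
  x ^+ i.+1 * (1 - x ^+ j.+1) *
   (qbin x (i + j.+1) i.+1 * epoch x i.+1 * epoch x j).
  by rewrite !epochS; ring.
(* Here 1 - x^(i+j+2) = (1 - x^(i+1)) + x^(i+1) (1 - x^(j+1)). *)
by rewrite H1 H2 exprD; ring.
Qed.

(* [jexp e r n j] is the exponent e i (i - 1) / 2 + r i for i = j - n. *)
Definition jexp (e r n j : nat) : nat :=
  if (n <= j)%N then (e * 'C(j - n, 2) + r * (j - n))%N
  else (e * 'C(n - j + 1, 2) - r * (n - j))%N.

(** The exponent grows by e i + r for i = j - n; adding e n to both sides stays within the naturals,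
    and r <= e makes the subtraction in [jexp] exact. *)
Lemma jexpS e r n j : (r <= e)%N ->
  (jexp e r n j.+1 + e * n = jexp e r n j + (e * j + r))%N.
Proof.
move=> le_re; rewrite /jexp.
have [le_nj|lt_jn] := leqP n j.
  rewrite leqW // subSn // binS bin1.
  have -> : j = (n + (j - n))%N by rewrite subnKC.
  rewrite addKn; set d := (j - n)%N; nia.
have [le_nj|lt_jn'] := leqP n j.+1.
  have -> : n = j.+1 by lia.
  by rewrite subnn subSnn /= muln0 addn0 binn bin_small //; nia.
have [d ->] : exists d, n = (j + d.+2)%N by exists (n - j.+2)%N; lia.
have -> : (j + d.+2 - j.+1 = d.+1)%N by lia.
have -> : (j + d.+2 - j = d.+2)%N by lia.
rewrite !addn1 (binS d.+2 1) bin1.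
have : (d.+1 <= 'C(d.+2, 2))%N by rewrite binS bin1; lia.
by set c := 'C(_, 2) => hc; nia.
Qed.

Lemma jexpSS e r n j : jexp e r n.+1 j.+1 = jexp e r n j.
Proof. by rewrite /jexp ltnS !subSS. Qed.

Lemma jexp0S e r n : (r <= e)%N ->
  jexp e r n.+1 0 = (jexp e r n 0 + (e * n.+1 - r))%N.
Proof. by move=> le_re; have := jexpS n.+1 0 le_re; rewrite jexpSS; lia. Qed.

(** Bookkeeping for multiplying a polynomial in z by a linear factor: [u] comes from its constant
    term, [v] from its term in z. *)
Lemma sum_shift (A : comNzRingType) (c u v : nat -> A) N :
  c 0 = u 0 -> (forall j, (j <= N)%N -> c j.+1 = u j.+1 + v j) -> u N.+1 = 0 ->
  \sum_(j < N.+2) c j = \sum_(j < N.+1) (u j + v j).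
Proof.
move=> c0 cS uN; rewrite big_ord_recl c0 big_split /=.
under eq_bigr => j _ do rewrite /bump /= add1n cS ?leq_ord //.
have -> : \sum_(j < N.+1) u j = \sum_(j < N.+2) u j.
  by rewrite [RHS]big_ord_recr /= uN addr0.
by rewrite big_split [in RHS]big_ord_recl addrA.
Qed.

(** Induction on the number of factors: a new factor of the first product is absorbed by [qbinS],
    one of the second by [qbinSr]. *)
Lemma finite_jacobi_triple (A : comNzRingType) (x z : A) e r n m : (r <= e)%N ->
  \prod_(k < n) (x ^+ (e * k.+1 - r) - z) * \prod_(k < m) (1 - z * x ^+ (e * k + r))
  = \sum_(j < (n + m).+1) (-1) ^+ j * x ^+ jexp e r n j * z ^+ j
      * qbin (x ^+ e) (n + m) j.
Proof.
move=> le_re; elim: m => [|m IH].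
  rewrite big_ord0 mulr1 addn0.
  elim: n => [|n IH].
    by rewrite big_ord0 big_ord1 /jexp /= bin_small // !muln0 !mul1r.
  rewrite big_ord_recr /= IH mulr_suml.
  rewrite (@sum_shift _
    (fun j => (-1) ^+ j * x ^+ jexp e r n.+1 j * z ^+ j * qbin (x ^+ e) n.+1 j)
    (fun j => (-1) ^+ j * x ^+ (jexp e r n j + (e * n.+1 - r)) * z ^+ j
      * qbin (x ^+ e) n j)
    (fun j => (-1) ^+ j.+1 * x ^+ jexp e r n j * z ^+ j.+1 * qbin (x ^+ e) n j)).
  - by apply: eq_bigr => j _; rewrite exprD !exprS; ring.
  - by rewrite jexp0S // !qbin0.
  - move=> j le_jn; rewrite jexpSS qbinS.
    have -> : (jexp e r n j.+1 + (e * n.+1 - r) = jexp e r n j + e * j.+1)%N.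
      by have := jexpS n j le_re; nia.
    by rewrite exprD -exprM; ring.
  - by rewrite qbin_gt ?mulr0.
rewrite big_ord_recr /= mulrA IH mulr_suml addnS.
rewrite (@sum_shift _
    (fun j => (-1) ^+ j * x ^+ jexp e r n j * z ^+ j * qbin (x ^+ e) (n + m).+1 j)
    (fun j => (-1) ^+ j * x ^+ jexp e r n j * z ^+ j * qbin (x ^+ e) (n + m) j)
    (fun j => (-1) ^+ j.+1 * x ^+ (jexp e r n j + (e * m + r)) * z ^+ j.+1
       * qbin (x ^+ e) (n + m) j)).
- by apply: eq_bigr => j _; rewrite !exprD !exprS; ring.
- by rewrite !qbin0.
- move=> j le_j; rewrite qbinSr // mulrDr addrC; congr (_ + _).
  have -> : (jexp e r n j + (e * m + r) = jexp e r n j.+1 + e * (n + m - j))%N.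
    by have := jexpS n j le_re; nia.
  by rewrite exprD -exprM; ring.
- by rewrite qbin_gt ?mulr0.
Qed.

(** * Truncation: evaluation at a nilpotent element *)

Lemma expr_ge_eq0 (A : comNzRingType) (x : A) M k :
  x ^+ M = 0 -> (M <= k)%N -> x ^+ k = 0.
Proof. by move=> xM le_Mk; rewrite -(subnKC le_Mk) exprD xM mul0r. Qed.

Lemma exprX_eq0 (A : comNzRingType) (x : A) M e :
  x ^+ M = 0 -> (0 < e)%N -> (x ^+ e) ^+ M = 0.
Proof. by move=> xM e_gt0; rewrite -exprM (expr_ge_eq0 xM) // leq_pmull. Qed.

Lemma nilp_gt0 (A : comNzRingType) (x : A) M : x ^+ M = 0 -> (0 < M)%N.
Proof. by case: M => // /eqP; rewrite expr0 oner_eq0. Qed.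

(** Factors with exponent at least M are 1, so the product is constant from m = M - 1 on. *)
Lemma epoch_stable (A : comNzRingType) (x : A) M m :
  x ^+ M = 0 -> (M <= m.+1)%N -> epoch x m = epoch x M.
Proof.
move=> xM; have M_gt0 := nilp_gt0 xM.
have aux k : epoch x (M.-1 + k) = epoch x M.-1.
  elim: k => [|k IH]; first by rewrite addn0.
  by rewrite addnS epochS IH (expr_ge_eq0 xM) ?subr0 ?mulr1 //; lia.
move=> le_Mm; have -> : m = (M.-1 + (m - M.-1))%N by lia.
by rewrite aux -(aux 1%N) addn1 prednK.
Qed.

Definition geom (A : comNzRingType) (y : A) (M : nat) : A := \sum_(j < M) y ^+ j.

Lemma geomK (A : comNzRingType) (y : A) M : y ^+ M = 0 -> (1 - y) * geom y M = 1.
Proof. by move=> yM; apply: oppr_inj; rewrite -mulNr opprB -subrX1 yM sub0r. Qed.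

(* For x nilpotent of order M, [einv x m M] is the inverse of [epoch x m]. *)
Definition einv (A : comNzRingType) (x : A) (m M : nat) : A :=
  \prod_(k < m) geom (x ^+ k.+1) M.

Lemma einvK (A : comNzRingType) (x : A) m M :
  x ^+ M = 0 -> epoch x m * einv x m M = 1.
Proof.
move=> xM; rewrite /epoch /einv -big_split big1 //= => k _.
by rewrite geomK // exprX_eq0.
Qed.

Lemma bin2_ge d : (d <= 'C(d.+1, 2))%N.
Proof. by rewrite binS bin1 leq_addl. Qed.

Lemma jexp_large e r n j M : (0 < e)%N -> (r <= e)%N ->
  (n + M < j)%N || (j + M < n)%N -> (M <= jexp e r n j)%N.
Proof.
move=> e_gt0 le_re /orP[lt_j|lt_n]; rewrite /jexp.
  have [d [ltMd ->]] : exists d, (M <= d)%N /\ j = (n + d.+1)%N.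
    by exists (j - n).-1; lia.
  by rewrite leq_addr addKn; have := bin2_ge d; set c := 'C(_, _); nia.
have [d [ltMd ->]] : exists d, (M <= d)%N /\ n = (j + d.+1)%N.
  by exists (n - j).-1; lia.
rewrite ifF; last by lia.
by rewrite addKn addn1 binS bin1; have := bin2_ge d; set c := 'C(_, _); nia.
Qed.

(** The limit of the finite identity: if j and 2 n - j are at least M, the Gaussian binomial is
    inverse to [epoch (x ^+ e) M]; for other j the power of x vanishes because n >= 2 M. *)
Lemma jacobi_triple (A : comNzRingType) (x z : A) e r n M :
  x ^+ M = 0 -> (0 < e)%N -> (r <= e)%N -> (2 * M <= n)%N ->
  epoch (x ^+ e) M *
    (\prod_(k < n) (x ^+ (e * k.+1 - r) - z) *
     \prod_(k < n) (1 - z * x ^+ (e * k + r)))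
  = \sum_(j < (n + n).+1) (-1) ^+ j * x ^+ jexp e r n j * z ^+ j.
Proof.
move=> xM e_gt0 le_re le_Mn; rewrite finite_jacobi_triple // mulr_sumr.
apply: eq_bigr => j _; set Q := x ^+ e.
have QM : Q ^+ M = 0 by apply: exprX_eq0.
have [/andP[le_Mj le_Mj']|far] := boolP ((M <= j) && (M <= n + n - j))%N; last first.
  by rewrite (expr_ge_eq0 xM) ?jexp_large //; [rewrite !(mulr0, mul0r) | lia].
suff E : epoch Q M * qbin Q (n + n) j = 1.
  by rewrite mulrCA E mulr1.
have le_j : (j <= n + n)%N by have := ltn_ord j; lia.
have := qbin_epoch Q j (n + n - j).
rewrite subnKC // !(epoch_stable QM) ?leqW //; last by lia.
move=> /(congr1 ( *%R^~ (einv Q M M))).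
by rewrite -mulrA einvK // mulr1 mulrC.
Qed.

(** Logarithmic differentiation; [l k] stands for f'/f at t, so nothing has to be inverted. *)
Lemma deriv_prod_horner (A : comNzRingType) n (f : nat -> {poly A}) (l : nat -> A) t :
  (forall k, (k < n)%N -> (f k)^`().[t] = (f k).[t] * l k) ->
  (\prod_(k < n) f k)^`().[t] = (\prod_(k < n) f k).[t] * \sum_(k < n) l k.
Proof.
elim: n => [|n IH] fl; first by rewrite !big_ord0 derivC horner0 mulr0.
rewrite !big_ord_recr /= derivM !(hornerD, hornerM) IH ?fl //; last first.
  by move=> k lt_kn; apply: fl; apply: ltnW.
ring.
Qed.

(** Pairs the indices m and - m - 1 counted from the centre j = n; j = 2 n is left over. *)
Lemma sum_fold (A : comNzRingType) (F : nat -> A) n :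
  \sum_(j < (n + n).+1) F j =
  \sum_(m < n) (F (n + m)%N + F (n - m.+1)%N) + F (n + n)%N.
Proof.
rewrite big_ord_recr big_split_ord /= big_split /=; congr (_ + _).
rewrite addrC; congr (_ + _).
by rewrite (reindex_inj rev_ord_inj).
Qed.

Lemma big_ord_mul3 (T : Type) (idx : T) (op : Monoid.com_law idx) (F : nat -> T) n :
  \big[op/idx]_(k < 3 * n) F k =
  \big[op/idx]_(k < n) op (op (F (3 * k)%N) (F (3 * k + 1)%N)) (F (3 * k + 2)%N).
Proof.
elim: n => [|n IH]; first by rewrite muln0 !big_ord0.
have -> : (3 * n.+1 = (3 * n).+3)%N by lia.
rewrite !big_ord_recr /= IH addn1 addn2 !Monoid.mulmA //.
Qed.

(** * Jacobi's identity and a cubic theta function *)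

(* The Jacobi triple product as a polynomial in z = 'X, multiplied by z^n up to sign. *)
Definition theta_prod (A : comNzRingType) (x : A) e r n : {poly A} :=
  \prod_(k < n) ((x ^+ (e * k.+1 - r))%:P - 'X) *
  \prod_(k < n) (1 - 'X * (x ^+ (e * k + r))%:P).

Lemma theta_prod_horner (A : comNzRingType) (x t : A) e r n :
  (theta_prod x e r n).[t] =
  \prod_(k < n) (x ^+ (e * k.+1 - r) - t) * \prod_(k < n) (1 - t * x ^+ (e * k + r)).
Proof.
rewrite /theta_prod hornerM !horner_prod; congr (_ * _);
  by apply: eq_bigr => k _; rewrite !hornerE.
Qed.

Lemma theta_prod_poly (A : comNzRingType) (x : A) e r n M :
  x ^+ M = 0 -> (0 < e)%N -> (r <= e)%N -> (2 * M <= n)%N ->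
  (epoch (x ^+ e) M)%:P * theta_prod x e r n =
  \sum_(j < (n + n).+1) ((-1) ^+ j * x ^+ jexp e r n j)%:P * 'X^j.
Proof.
move=> xM e_gt0 le_re le_Mn.
have xPM : x%:P ^+ M = 0 by rewrite -rmorphXn xM.
have := jacobi_triple 'X xPM e_gt0 le_re le_Mn.
rewrite -rmorphXn /= {1}/epoch => H.
rewrite /epoch rmorph_prod /=.
under eq_bigr => k _ do rewrite rmorphB rmorph1 rmorphXn /=.
rewrite /theta_prod.
under [X in _ * (X * _)]eq_bigr => k _ do rewrite rmorphXn /=.
under [X in _ * (_ * X)]eq_bigr => k _ do rewrite rmorphXn /=.
rewrite H; apply: eq_bigr => j _.
by rewrite rmorphM rmorphXn rmorphN1 rmorphXn.
Qed.

Lemma theta_value (A : comNzRingType) (x : A) e r n M :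
  x ^+ M = 0 -> (0 < e)%N -> (r <= e)%N -> (2 * M <= n)%N ->
  epoch (x ^+ e) M * (theta_prod x e r n).[1] =
  \sum_(j < (n + n).+1) (-1) ^+ j * x ^+ jexp e r n j.
Proof.
move=> xM e_gt0 le_re le_Mn.
have /(congr1 (horner^~ 1)) := theta_prod_poly xM e_gt0 le_re le_Mn.
rewrite /= hornerM hornerC horner_sum => ->.
by apply: eq_bigr => j _; rewrite hornerM hornerC hornerXn expr1n mulr1.
Qed.

Lemma theta_deriv (A : comNzRingType) (x : A) e r n M :
  x ^+ M = 0 -> (0 < e)%N -> (r <= e)%N -> (2 * M <= n)%N ->
  epoch (x ^+ e) M * (theta_prod x e r n)^`().[1] =
  \sum_(j < (n + n).+1) (-1) ^+ j * x ^+ jexp e r n j * j%:R.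
Proof.
move=> xM e_gt0 le_re le_Mn.
have /(congr1 (fun p => p^`().[1])) := theta_prod_poly xM e_gt0 le_re le_Mn.
rewrite /= derivM derivC mul0r add0r hornerM hornerC raddf_sum horner_sum => ->.
apply: eq_bigr => j _; rewrite /= derivM derivC mul0r add0r derivXn.
by rewrite hornerM hornerC hornerMn hornerXn expr1n.
Qed.

Lemma jexp_ge e r n m : jexp e r n (n + m) = (e * 'C(m, 2) + r * m)%N.
Proof. by rewrite /jexp leq_addr addKn. Qed.

Lemma jexp_lt e r n m : (m < n)%N ->
  jexp e r n (n - m.+1) = (e * 'C(m.+2, 2) - r * m.+1)%N.
Proof.
move=> lt_mn; rewrite /jexp ifF; last by lia.
by rewrite subKn // addn1.
Qed.

Lemma signr_even (A : comNzRingType) n k : ~~ odd n ->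
  (-1) ^+ (n + k) = (-1) ^+ k :> A.
Proof. by move=> n_even; rewrite exprD -signr_odd (negPf n_even) mul1r. Qed.

Lemma signr_evenB (A : comNzRingType) n k : ~~ odd n -> (k <= n)%N ->
  (-1) ^+ (n - k) = (-1) ^+ k :> A.
Proof.
move=> n_even le_kn.
by rewrite -signr_odd oddB // (negPf n_even) signr_odd.
Qed.

(** Differentiate the triple product with e = r = 1 at z = 1: its factor 1 - z vanishes there, so
    only minus the product of the other factors survives. For even [n] the shift by z^n leaves the
    signs alone. *)
Lemma jacobi_cube (A : comNzRingType) (x : A) n M :
  x ^+ M = 0 -> (2 * M <= n)%N -> ~~ odd n ->
  epoch x M ^+ 3 = \sum_(m < n) (-1) ^+ m * (2 * m + 1)%:R * x ^+ 'C(m.+1, 2).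
Proof.
move=> xM le_Mn n_even; have M_gt0 := nilp_gt0 xM.
have T := @theta_value _ x 1 1 n M xM isT isT le_Mn.
have D := @theta_deriv _ x 1 1 n M xM isT isT le_Mn.
have [n' En] : exists n', n = n'.+1 by exists n.-1; lia.
have pE : theta_prod x 1 1 n = (1 - 'X) *
    (\prod_(k < n') ((x ^+ k.+1)%:P - 'X) * \prod_(k < n) (1 - 'X * (x ^+ k.+1)%:P)).
  rewrite En /theta_prod big_ord_recl /= subnn expr0 -mulrA.
  congr (_ * (_ * _)); apply: eq_bigr => k _.
    by rewrite /bump /= mul1n add1n subn1.
  by rewrite mul1n addn1.
rewrite expr1 pE in T; rewrite expr1 pE in D.
move: D; rewrite derivM derivB derivX derivC sub0r mulN1r hornerD hornerN.
rewrite !(hornerM (1 - 'X)) !hornerE subrr mul0r addr0.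
rewrite !horner_prod.
under [X in _ * - (X * _)]eq_bigr => k _ do rewrite !hornerE -opprB -mulN1r.
under [X in _ * - (_ * X)]eq_bigr => k _ do rewrite !hornerE.
rewrite big_split /= prodr_const card_ord => D.
move: T; rewrite (hornerM (1 - 'X)) hornerD hornerN hornerX hornerC subrr mul0r mulr0 => T.
have sgn : (-1) ^+ n' = -1 :> A.
  by rewrite -signr_odd; move: n_even; rewrite En /= negbK => ->.
rewrite sgn -/(epoch x n') -/(epoch x n) !(epoch_stable xM) in D; try lia.
have -> : epoch x M ^+ 3 = epoch x M * - (-1 * epoch x M * epoch x M) by ring.
rewrite D.
(* The theta sum vanishes at z = 1, so the weight j may be recentred to j - n. *)
transitivity (\sum_(j < (n + n).+1) (-1) ^+ j * x ^+ jexp 1 1 n j * (j%:R - n%:R)).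
  under [RHS]eq_bigr => j _ do rewrite mulrBr.
  by rewrite sumrB -mulr_suml -T mul0r subr0.
rewrite (sum_fold (fun j => (-1) ^+ j * x ^+ jexp 1 1 n j * (j%:R - n%:R))).
rewrite jexp_ge [x ^+ (_ * 'C(n, 2) + _)](expr_ge_eq0 xM); last by lia.
rewrite mulr0 mul0r addr0; apply: eq_bigr => m _.
rewrite jexp_ge jexp_lt // signr_even // signr_evenB //.
have -> : (1 * 'C(m, 2) + 1 * m = 'C(m.+1, 2))%N by rewrite binS bin1; lia.
have -> : (1 * 'C(m.+2, 2) - 1 * m.+1 = 'C(m.+1, 2))%N by rewrite binS bin1; lia.
rewrite natrB // (natrD _ n m) (natrD _ _ 1) natrM exprS -natr1.
by ring.
Qed.

(* The sum over all integers i of (-1)^i (6 i + 1) x^(i (3 i + 1) / 2), with the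
   terms i = m and i = - m - 1 grouped. *)
Definition ptheta (A : comNzRingType) (x : A) (n : nat) : A :=
  \sum_(m < n) (-1) ^+ m * ((6 * m + 1)%:R * x ^+ (3 * 'C(m, 2) + 2 * m)
                         + (6 * m + 5)%:R * x ^+ (3 * 'C(m.+1, 2) + m.+1)).

(** A truncation of (a(q) - 1) / 6, with [y * geom y M] for y / (1 - y). *)
Definition lambert3 (A : comNzRingType) (x : A) (n M : nat) : A :=
  \sum_(k < n) (x ^+ (3 * k + 1) * geom (x ^+ (3 * k + 1)) M
              - x ^+ (3 * k + 2) * geom (x ^+ (3 * k + 2)) M).

(** Apply 1 + 6 z d/dz to the triple product with e = 3, r = 2, divided by z^n, at z = 1; on the
    product side this is a logarithmic derivative. *)
Lemma ptheta_lambert (A : comNzRingType) (x : A) n M :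
  x ^+ M = 0 -> (2 * M <= n)%N -> ~~ odd n ->
  ptheta x n = epoch x M * (1 + 6%:R * lambert3 x n M).
Proof.
move=> xM le_Mn n_even; have M_gt0 := nilp_gt0 xM.
have T := @theta_value _ x 3 2 n M xM isT isT le_Mn.
have D := @theta_deriv _ x 3 2 n M xM isT isT le_Mn.
(* At z = 1 the two products carry the exponents 3 k + 1 and 3 k + 2, and E_3 supplies the multiples
   of 3. *)
have value : epoch (x ^+ 3) M * (theta_prod x 3 2 n).[1] = epoch x M.
  rewrite -(epoch_stable xM (m := 3 * n)); last by lia.
  rewrite -(epoch_stable (exprX_eq0 xM (isT : 0 < 3)%N) (m := n)); last by lia.
  rewrite /epoch (big_ord_mul3 _ (fun k => 1 - x ^+ k.+1)) !big_split /=.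
  rewrite mulrC theta_prod_horner; congr (_ * _ * _).
  - under eq_bigr => k _ do rewrite -opprB -mulN1r.
    rewrite big_split /= prodr_const card_ord.
    rewrite -signr_odd (negPf n_even) mul1r; apply: eq_bigr => k _.
    by have -> : (3 * k.+1 - 2 = (3 * k).+1)%N by lia.
  - by apply: eq_bigr => k _; rewrite mul1r addn1 addn2.
  - by apply: eq_bigr => k _; rewrite -exprM -addnS -mulnSr.
have deriv : (theta_prod x 3 2 n)^`().[1] =
    (theta_prod x 3 2 n).[1] * (n%:R + lambert3 x n M).
  rewrite /theta_prod derivM hornerD !hornerM.
  (* The logarithmic derivative of y - z at 1 is 1 / (1 - y) = 1 + y / (1 - y); the ones add up to
     the n of the shift. *)
  rewrite (@deriv_prod_horner _ _ (fun k => (x ^+ (3 * k.+1 - 2))%:P - 'X)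
    (fun k => 1 + x ^+ (3 * k + 1) * geom (x ^+ (3 * k + 1)) M)); last first.
    move=> k _; rewrite !derivE !hornerE.
    have -> : (3 * k.+1 - 2 = 3 * k + 1)%N by lia.
    have H : (1 - x ^+ (3 * k + 1)) * geom (x ^+ (3 * k + 1)) M = 1.
      by rewrite geomK // exprX_eq0 // addn1.
    have -> : (x ^+ (3 * k + 1) - 1) * (1 + x ^+ (3 * k + 1) * geom (x ^+ (3 * k + 1)) M)
      = x ^+ (3 * k + 1) - 1 - x ^+ (3 * k + 1) *
         ((1 - x ^+ (3 * k + 1)) * geom (x ^+ (3 * k + 1)) M) by ring.
    by rewrite H; ring.
  rewrite (@deriv_prod_horner _ _ (fun k => 1 - 'X * (x ^+ (3 * k + 2))%:P)
    (fun k => - (x ^+ (3 * k + 2) * geom (x ^+ (3 * k + 2)) M))); last first.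
    move=> k _; rewrite !derivE !hornerE.
    have H : (1 - x ^+ (3 * k + 2)) * geom (x ^+ (3 * k + 2)) M = 1.
      by rewrite geomK // exprX_eq0 // addn2.
    have -> : (1 - x ^+ (3 * k + 2)) * - (x ^+ (3 * k + 2) * geom (x ^+ (3 * k + 2)) M)
      = - x ^+ (3 * k + 2) *
         ((1 - x ^+ (3 * k + 2)) * geom (x ^+ (3 * k + 2)) M) by ring.
    by rewrite H; ring.
  rewrite /lambert3 sumrN sumrB big_split /= sumr_const card_ord; ring.
rewrite mulrDr mulr1.
transitivity (\sum_(j < (n + n).+1)
    (-1) ^+ j * x ^+ jexp 3 2 n j * (1 + 6%:R * (j%:R - n%:R))); last first.
  under eq_bigr => j _ do rewrite mulrDr mulr1 mulrCA mulrBr.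
  rewrite big_split /= -T -mulr_sumr sumrB -mulr_suml -T -D deriv.
  rewrite [in LHS](mulrA (epoch _ _)) value.
  by ring.
rewrite (sum_fold (fun j => (-1) ^+ j * x ^+ jexp 3 2 n j * (1 + 6%:R * (j%:R - n%:R)))).
rewrite jexp_ge [x ^+ (_ * 'C(n, 2) + _)](expr_ge_eq0 xM); last by lia.
rewrite mulr0 mul0r addr0; apply: eq_bigr => m _.
rewrite jexp_ge jexp_lt // signr_even // signr_evenB //.
have -> : (3 * 'C(m.+2, 2) - 2 * m.+1 = 3 * 'C(m.+1, 2) + m.+1)%N.
  by rewrite binS bin1; lia.
rewrite natrB // (natrD _ n m) (natrD _ _ 1) (natrD _ _ 5) natrM exprS -natr1.
by ring.
Qed.

(** * The 3-dissection *)

Lemma bin2_double d : (2 * 'C(d.+1, 2) = d.+1 * d)%N.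
Proof. by rewrite -mul_bin_diag bin1. Qed.

(** In Jacobi's sum, m (m + 1) / 2 is divisible by 3 for m = 3 k and m = 3 k + 2, while m = 3 k + 1
    gives 9 k (k + 1) / 2 + 1 with weight 3 (2 k + 1), again a Jacobi sum. *)
Lemma epoch_cube_dissection (A : comNzRingType) (x : A) M : x ^+ M = 0 ->
  epoch x M ^+ 3 = ptheta (x ^+ 3) (2 * M) - 3%:R * x * epoch (x ^+ 9) M ^+ 3.
Proof.
move=> xM; rewrite (@jacobi_cube _ x (3 * (2 * M)) M) //; try lia.
rewrite (big_ord_mul3 _ (fun m => (-1) ^+ m * (2 * m + 1)%:R * x ^+ 'C(m.+1, 2))).
rewrite (@jacobi_cube _ (x ^+ 9) (2 * M) M) ?exprX_eq0 //; try lia.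
rewrite mulr_sumr /ptheta -sumrB; apply: eq_bigr => k _ /=.
have sgn : (-1) ^+ (3 * k) = (-1) ^+ k :> A.
  by rewrite exprM !exprS expr0 mulr1 !mulN1r opprK.
have e0 : ('C((3 * k).+1, 2) = 3 * (3 * 'C(k, 2) + 2 * k))%N.
  have := bin2_double (3 * k); case: (nat_of_ord k) => [|d] _ //.
  by have := bin2_double d; have := bin2_double (3 * d.+1); nia.
have e1 : ('C((3 * k + 1).+1, 2) = (9 * 'C(k.+1, 2)).+1)%N.
  by have := bin2_double (3 * k + 1); have := bin2_double k; nia.
have e2 : ('C((3 * k + 2).+1, 2) = 3 * (3 * 'C(k.+1, 2) + k.+1))%N.
  by have := bin2_double (3 * k + 2); have := bin2_double k; nia.
rewrite e0 e1 e2 -!exprM (exprD _ _ 1) (exprD _ _ 2) sgn expr1 sqrrN expr1n exprS.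
have -> : (2 * (3 * k) + 1 = 6 * k + 1)%N by lia.
have -> : (2 * (3 * k + 1) + 1 = 3 * (2 * k + 1))%N by lia.
have -> : (2 * (3 * k + 2) + 1 = 6 * k + 5)%N by lia.
by rewrite natrM !exprM !mulrDr; ring.
Qed.

Lemma cube_root_norm (A : comNzRingType) (w a : A) : w ^+ 2 + w + 1 = 0 ->
  (1 - a) * (1 - w * a) * (1 - w ^+ 2 * a) = 1 - a ^+ 3.
Proof.
move=> w0.
have -> : (1 - a) * (1 - w * a) * (1 - w ^+ 2 * a) = 1 - a ^+ 3 +
  (w ^+ 2 + w + 1) * (- a + w * a ^+ 2 + (1 - w) * a ^+ 3) by ring.
by rewrite w0 mul0r addr0.
Qed.

Lemma cube_root_exp3 (A : comNzRingType) (w : A) : w ^+ 2 + w + 1 = 0 -> w ^+ 3 = 1.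
Proof.
move=> w0; have -> : w ^+ 3 = 1 + (w - 1) * (w ^+ 2 + w + 1) by ring.
by rewrite w0 mulr0 addr0.
Qed.

(** Over the three conjugates, an exponent m divisible by 3 gives (1 - x^m)^3 and any other m gives
    1 - x^(3 m); E_9 supplies the missing factors of E_3. *)
Lemma epoch_norm (A : comNzRingType) (w x : A) L : w ^+ 2 + w + 1 = 0 ->
  epoch x (3 * L) * epoch (w * x) (3 * L) * epoch (w ^+ 2 * x) (3 * L)
    * epoch (x ^+ 9) L
  = epoch (x ^+ 3) L ^+ 3 * epoch (x ^+ 3) (3 * L).
Proof.
move=> w0; have w3 := cube_root_exp3 w0.
rewrite /epoch (big_ord_mul3 _ (fun k => 1 - x ^+ k.+1)).
rewrite (big_ord_mul3 _ (fun k => 1 - (w * x) ^+ k.+1)).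
rewrite (big_ord_mul3 _ (fun k => 1 - (w ^+ 2 * x) ^+ k.+1)).
rewrite (big_ord_mul3 _ (fun k => 1 - (x ^+ 3) ^+ k.+1)).
rewrite -prodrXl -!big_split; apply: eq_bigr => k _ /=.
have -> : x ^+ 9 ^+ k.+1 = (x ^+ (3 * k).+3) ^+ 3.
  by rewrite -!exprM; congr (_ ^+ _); lia.
have -> : (x ^+ 3) ^+ k.+1 = x ^+ (3 * k).+3.
  by rewrite -!exprM; congr (_ ^+ _); lia.
rewrite !addn1 !addn2 !(exprAC x 3) !(exprMn _ w) !(exprMn _ (w ^+ 2)) !(exprAC w 2).
have -> : w ^+ (3 * k).+1 = w by rewrite exprS exprM w3 expr1n mulr1.
have -> : w ^+ (3 * k).+2 = w ^+ 2 by rewrite !exprS exprM w3 expr1n.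
have -> : w ^+ (3 * k).+3 = 1 by rewrite -addn3 -mulnSr exprM w3 expr1n.
rewrite expr1n !mul1r.
rewrite -(cube_root_norm (x ^+ (3 * k).+1) w0) -(cube_root_norm (x ^+ (3 * k).+2) w0).
have -> : (w ^+ 2) ^+ 2 = w by rewrite -exprM exprS w3 mulr1.
by ring.
Qed.

Lemma ptheta_cube (A : comNzRingType) (w x : A) M :
  w ^+ 2 + w + 1 = 0 -> x ^+ M = 0 ->
  (ptheta (x ^+ 3) (2 * M) ^+ 3 - 27%:R * x ^+ 3 * epoch (x ^+ 9) M ^+ 9)
    * epoch (x ^+ 9) M ^+ 3 = epoch (x ^+ 3) M ^+ 12.
Proof.
move=> w0 xM; have w3 := cube_root_exp3 w0.
have wxM : (w * x) ^+ M = 0 by rewrite exprMn xM mulr0.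
have wwxM : (w ^+ 2 * x) ^+ M = 0 by rewrite exprMn xM mulr0.
have x3M : (x ^+ 3) ^+ M = 0 by rewrite exprX_eq0.
have N := epoch_norm x M w0.
rewrite !(epoch_stable xM, epoch_stable wxM, epoch_stable wwxM, epoch_stable x3M) in N;
  try lia.
have C1 := epoch_cube_dissection xM.
have C2 := epoch_cube_dissection wxM.
have C3 := epoch_cube_dissection wwxM.
have w23 : (w ^+ 2) ^+ 3 = 1 by rewrite exprAC w3 expr1n.
have w9 : w ^+ 9 = 1 by rewrite (exprM w 3 3) w3 expr1n.
have w29 : (w ^+ 2) ^+ 9 = 1 by rewrite exprAC w9 expr1n.
(* The conjugates share P(x^3) and E_9, since w^3 = 1. *)
rewrite !(exprMn _ w) w3 w9 !mul1r in C2.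
rewrite !(exprMn _ (w ^+ 2)) w23 w29 !mul1r in C3.
have -> : epoch (x ^+ 3) M ^+ 12 = (epoch (x ^+ 3) M ^+ 3 * epoch (x ^+ 3) M) ^+ 3.
  by ring.
rewrite -N 3!exprMn C1 C2 C3; congr (_ * _).
move: (ptheta _ _) (epoch (x ^+ 9) M) => p t.
have -> : (p - 3%:R * x * t ^+ 3) * (p - 3%:R * (w * x) * t ^+ 3) *
    (p - 3%:R * (w ^+ 2 * x) * t ^+ 3) =
    p ^+ 3 - 27%:R * w ^+ 3 * x ^+ 3 * t ^+ 9 + (w ^+ 2 + w + 1) *
      (- 3%:R * x * t ^+ 3 * p ^+ 2 + 9%:R * w * x ^+ 2 * t ^+ 6 * p) by ring.
by rewrite w0 w3 mul0r addr0 mulr1.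
Qed.

(* (x^3; x^3) / (x; x), written so that its coefficients are visibly nonnegative. *)
Definition e3quot (A : comNzRingType) (x : A) (m : nat) : A :=
  \prod_(k < m) (1 + x ^+ k.+1 + (x ^+ k.+1) ^+ 2).

Lemma e3quotE (A : comNzRingType) (x : A) M : x ^+ M.+1 = 0 ->
  e3quot x M = epoch (x ^+ 3) M.+1 * einv x M M.+1.
Proof.
move=> xM; rewrite -(@epoch_stable _ (x ^+ 3) _ M) ?exprX_eq0 //.
have -> : epoch (x ^+ 3) M = e3quot x M * epoch x M.
  rewrite /epoch /e3quot -big_split; apply: eq_bigr => k _ /=.
  by rewrite exprAC; ring.
by rewrite -mulrA einvK // mulr1.
Qed.

(* [(1 + 6 lambert3) / epoch], with the factor 1 - x cancelled as in [aeinvE] so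
   that its coefficients are visibly nonnegative. *)
Definition aeinv (A : comNzRingType) (x : A) (m M : nat) : A :=
  einv x m M + 6%:R * \sum_(k < 2 * M) x ^+ (3 * k + 1) * geom (x ^+ (3 * k + 1)) M
    * geom (x ^+ (3 * k + 2)) M * \prod_(1 <= i < m) geom (x ^+ i.+1) M.

Lemma aeinvE (A : comNzRingType) (x : A) M : x ^+ M.+1 = 0 ->
  aeinv x M M.+1 = (1 + 6%:R * lambert3 x (2 * M.+1) M.+1) * einv x M M.+1.
Proof.
move=> xM; rewrite /aeinv [RHS]mulrDl mul1r -mulrA; congr (_ + _ * _).
rewrite /lambert3 mulr_suml; apply: eq_bigr => k _.
(* For M = 0 the product [einv] is empty and offers no factor to cancel against 1 - x, but then x =
   0. *)
move: (nat_of_ord k) => {}k; case: M xM => [|M] xM.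
  rewrite /einv expr1 in xM *.
  by rewrite xM !addn1 !addn2 !exprS !mul0r subrr mul0r.
have -> : \prod_(1 <= i < M.+1) geom (x ^+ i.+1) M.+2 = (1 - x) * einv x M.+1 M.+2.
  rewrite /einv big_ord_recl /= expr1 mulrA geomK // mul1r.
  by rewrite big_add1 /= big_mkord.
have H1 : (1 - x ^+ (3 * k + 1)) * geom (x ^+ (3 * k + 1)) M.+2 = 1.
  by rewrite geomK // exprX_eq0 // addn1.
have H2 : (1 - x ^+ (3 * k + 2)) * geom (x ^+ (3 * k + 2)) M.+2 = 1.
  by rewrite geomK // exprX_eq0 // addn2.
rewrite !mulrA; congr (_ * _).
move: H1 H2; have -> : x ^+ (3 * k + 2) = x * x ^+ (3 * k + 1) by rewrite -exprS addnS.
move: (x ^+ (3 * k + 1)) => y; move: (geom y _) (geom (x * y) _) => g1 g2 H1 H2.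
(* This is y / (1 - y) - x y / (1 - x y) = y (1 - x) / ((1 - y) (1 - x y)). *)
transitivity (y * g1 * ((1 - x * y) * g2) - x * y * g2 * ((1 - y) * g1)).
  by ring.
by rewrite H1 H2 !mulr1.
Qed.

(** P = E_1 a(q), hence P / E_1^2 = a(q) / E_1. *)
Lemma ptheta_einv (A : comNzRingType) (x : A) M : x ^+ M.+1 = 0 ->
  ptheta x (2 * M.+1) * einv x M M.+1 ^+ 2 = aeinv x M M.+1.
Proof.
move=> xM; rewrite (@ptheta_lambert _ x _ M.+1) //; try lia.
rewrite aeinvE // -(@epoch_stable _ x _ M) //.
move: (einvK M xM); move: (epoch _ _) (einv _ _ _) (lambert3 _ _ _) => e v l H.
have -> : e * (1 + 6%:R * l) * v ^+ 2 = (e * v) * (1 + 6%:R * l) * v by ring.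
by rewrite H mul1r.
Qed.

Lemma quotient_dissection (A : comNzRingType) (w x : A) M :
  w ^+ 2 + w + 1 = 0 -> x ^+ M.+1 = 0 ->
  let G y := aeinv y M M.+1 in let H y := e3quot y M in let W y := einv y M M.+1 in
  epoch x M ^+ 9 * W (x ^+ 3) ^+ 9 =
    G (x ^+ 9) * W (x ^+ 9) - 3%:R * x ^+ 3 * H (x ^+ 9) ^+ 3
    - 9%:R * x * (G (x ^+ 3) ^+ 2 * H (x ^+ 3) ^+ 3 * W (x ^+ 3) ^+ 2)
    + 27%:R * x ^+ 2 * (G (x ^+ 3) * H (x ^+ 3) ^+ 6 * W (x ^+ 3)).
Proof.
move=> w0 xM G H W.
have x3M : (x ^+ 3) ^+ M.+1 = 0 by rewrite exprX_eq0.
have x9M : (x ^+ 9) ^+ M.+1 = 0 by rewrite exprX_eq0.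
have D1 := epoch_cube_dissection xM.
have D3 := epoch_cube_dissection x3M.
have N := ptheta_cube w0 xM.
have V3 := einvK M x3M; have V9 := einvK M x9M.
rewrite (epoch_stable x3M) // in V3; rewrite (epoch_stable x9M) // in V9.
have P3 := ptheta_einv x3M; have P9 := ptheta_einv x9M.
have H3 := e3quotE x3M; have H9 := e3quotE x9M.
rewrite -!exprM /= in D3 H3 H9.
rewrite (epoch_stable xM) // (exprM _ 3 3) D1.
rewrite /G /H /W -P3 -P9 H3 H9.
move: (einv (x ^+ 3) _ _) (einv (x ^+ 9) _ _) V3 V9 => v3 v9 V3 V9.
move: N D3 V3 V9.
rewrite -[(3 * 3)%N]/9%N -[(9 * 3)%N]/27%N.
move: (epoch (x ^+ 3) _) (epoch (x ^+ 9) _) (epoch (x ^+ 27) _) => e3 e9 e27.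
move: (ptheta (x ^+ 3) _) (ptheta (x ^+ 9) _) => p3 p9 N D3 V3 V9.
(* The cube is expanded with its first and last terms kept together. *)
have -> : (p3 - 3%:R * x * e9 ^+ 3) ^+ 3 * v3 ^+ 9 =
    (p3 ^+ 3 - 27%:R * x ^+ 3 * e9 ^+ 9) * v3 ^+ 9
    - 9%:R * x * p3 ^+ 2 * e9 ^+ 3 * v3 ^+ 9
    + 27%:R * x ^+ 2 * p3 * e9 ^+ 6 * v3 ^+ 9 by ring.
(* By [N] the bracket is E_3^12 / E_9^3; this leaves E_3^3 / E_9^3, which [D3] dissects once
   more. *)
have -> : (p3 ^+ 3 - 27%:R * x ^+ 3 * e9 ^+ 9) * v3 ^+ 9 =
    (p9 - 3%:R * x ^+ 3 * e27 ^+ 3) * v9 ^+ 3.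
  rewrite -D3.
  transitivity ((p3 ^+ 3 - 27%:R * x ^+ 3 * e9 ^+ 9) * v3 ^+ 9 * (e9 * v9) ^+ 3).
    by rewrite V9 expr1n mulr1.
  have -> : forall u, u * v3 ^+ 9 * (e9 * v9) ^+ 3 =
    u * e9 ^+ 3 * (v3 ^+ 9 * v9 ^+ 3) by move=> u; ring.
  rewrite N.
  have -> : e3 ^+ 12 * (v3 ^+ 9 * v9 ^+ 3) = (e3 * v3) ^+ 9 * (e3 ^+ 3 * v9 ^+ 3).
    by ring.
  by rewrite V3 expr1n mul1r.
by ring.
Qed.

(** * Positivity and extraction of coefficients *)

(** This and the next four lemmas serve the substitutions X -> X^k and the reduction modulo
    X^(n+1). *)
Lemma rmorph_geom (A B : comNzRingType) (f : {rmorphism A -> B}) x M :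
  f (geom x M) = geom (f x) M.
Proof. by rewrite rmorph_sum; apply: eq_bigr => i _; rewrite rmorphXn. Qed.

Lemma rmorph_epoch (A B : comNzRingType) (f : {rmorphism A -> B}) x m :
  f (epoch x m) = epoch (f x) m.
Proof.
rewrite rmorph_prod; apply: eq_bigr => k _.
by rewrite rmorphB rmorph1 rmorphXn.
Qed.

Lemma rmorph_einv (A B : comNzRingType) (f : {rmorphism A -> B}) x m M :
  f (einv x m M) = einv (f x) m M.
Proof.
rewrite rmorph_prod; apply: eq_bigr => k _.
by rewrite rmorph_geom rmorphXn.
Qed.

Lemma rmorph_e3quot (A B : comNzRingType) (f : {rmorphism A -> B}) x m :
  f (e3quot x m) = e3quot (f x) m.
Proof.
rewrite rmorph_prod; apply: eq_bigr => k _.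
by rewrite !rmorphD rmorph1 !rmorphXn.
Qed.

Lemma rmorph_aeinv (A B : comNzRingType) (f : {rmorphism A -> B}) x m M :
  f (aeinv x m M) = aeinv (f x) m M.
Proof.
rewrite /aeinv rmorphD rmorphM rmorph_nat rmorph_einv rmorph_sum.
congr (_ + _ * _); apply: eq_bigr => k _.
rewrite !rmorphM !rmorph_geom !rmorphXn rmorph_prod.
by congr (_ * _); apply: eq_bigr => i _; rewrite rmorph_geom rmorphXn.
Qed.

(* [Num.nneg] is a qualifier; the closure properties that [polyOver] needs are
   attached to the underlying predicate. *)
Definition pos_upto (R : numDomainType) (M : nat) (p : {poly R}) : Prop :=
  p \is a polyOver (@Num.Def.nneg_num_pred R) /\ forall i, (i < M)%N -> 0 < p`_i.

Lemma coefM_gt0 (R : numDomainType) (p q : {poly R}) i j :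
  p \is a polyOver (@Num.Def.nneg_num_pred R) -> q \is a polyOver (@Num.Def.nneg_num_pred R) ->
  0 < p`_i -> 0 < q`_j -> 0 < (p * q)`_(i + j).
Proof.
move=> /polyOverP p0 /polyOverP q0 pi qj; rewrite coefM.
have lt_i : (i < (i + j).+1)%N by lia.
rewrite (bigD1 (Ordinal lt_i)) //= addKn ltr_wpDr ?mulr_gt0 //.
by apply: sumr_ge0 => k _; rewrite mulr_ge0 // -nnegrE.
Qed.

Lemma pos_uptoM (R : numDomainType) M (p q : {poly R}) :
  pos_upto M p -> pos_upto M q -> pos_upto M (p * q).
Proof.
move=> [p0 p1] [q0 q1]; split=> [|i lt_iM]; first by rewrite rpredM.
by rewrite -[i]addn0 coefM_gt0 ?p1 ?q1 //; lia.
Qed.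

Lemma pos_uptoX (R : numDomainType) M (p : {poly R}) k :
  pos_upto M p -> pos_upto M (p ^+ k.+1).
Proof.
by move=> p_pos; elim: k => [|k IH]; rewrite ?expr1 // exprS; apply: pos_uptoM.
Qed.

Lemma pos_uptoD (R : numDomainType) M (p q : {poly R}) :
  pos_upto M p -> q \is a polyOver (@Num.Def.nneg_num_pred R) -> pos_upto M (p + q).
Proof.
move=> [p0 p1] q0; split=> [|i lt_iM]; first by rewrite rpredD.
by rewrite coefD ltr_wpDr ?p1 // -nnegrE; apply/polyOverP.
Qed.

(** Factor i contributes its coefficient of X^(i+1), the others their constant terms, and no other
    contribution is negative. *)
Lemma pos_upto_prod (R : numDomainType) m (f : nat -> {poly R}) :
  (forall k, f k \is a polyOver (@Num.Def.nneg_num_pred R)) -> (forall k, 0 < (f k)`_0) ->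
  (forall k, (k < m)%N -> 0 < (f k)`_k.+1) -> pos_upto m.+1 (\prod_(k < m) f k).
Proof.
move=> f_nneg f0 fS.
have nn (P : pred 'I_m) : \prod_(k < m | P k) f k \is a polyOver (@Num.Def.nneg_num_pred R).
  by apply: rpred_prod.
have prod0 (P : pred 'I_m) : 0 < (\prod_(k < m | P k) f k)`_0.
  by rewrite -horner_coef0 horner_prod prodr_gt0 // => k _; rewrite horner_coef0.
split=> [|[|i] lt_im]; [exact: nn | exact: prod0 | ].
rewrite (bigD1 (Ordinal (lt_im : (i < m)%N))) //= -[i.+1]addn0.
by apply: coefM_gt0 => //; apply: fS.
Qed.

Lemma nneg_geomX (R : numDomainType) k M :
  geom 'X^k M \is a polyOver (@Num.Def.nneg_num_pred R).
Proof. by apply: rpred_sum => i _; rewrite !rpredX ?polyOverX. Qed.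

Lemma geomX_coef (R : numDomainType) k M j : (j < M)%N -> (0 < k)%N ->
  0 < (geom 'X^k M : {poly R})`_(k * j).
Proof.
move=> lt_jM k_gt0; rewrite /geom (bigD1 (Ordinal lt_jM)) //= coefD -exprM coefXn eqxx.
rewrite ltr_wpDr ?ltr01 // -nnegrE; apply/polyOverP.
by apply: rpred_sum => i _; rewrite !rpredX ?polyOverX.
Qed.

Lemma einv_pos (R : numDomainType) n : pos_upto n.+1 (einv ('X : {poly R}) n n.+1).
Proof.
apply: (@pos_upto_prod R n (fun k => geom ('X^(k.+1)) n.+1)) => [k|k|k lt_kn]; first exact: nneg_geomX.
  by rewrite -[0%N](muln0 k.+1) geomX_coef.
by rewrite -[X in _`_X](muln1 k.+1) geomX_coef //; lia.
Qed.

Lemma e3quot_pos (R : numDomainType) n : pos_upto n.+1 (e3quot ('X : {poly R}) n).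
Proof.
pose f k : {poly R} := 1 + 'X^(k.+1) + 'X^(k.+1) ^+ 2.
suff: pos_upto n.+1 (\prod_(k < n) f k) by [].
apply: pos_upto_prod => [k|k|k _]; rewrite /f -exprM.
- by rewrite !rpredD ?rpred1 ?rpredX ?polyOverX.
- by rewrite !coefD !coefXn coef1 /= !addr0 ltr01.
rewrite !coefD !coefXn coef1 eqxx /= add0r.
by rewrite ltr_wpDr ?ltr01 // ler0n.
Qed.

Lemma aeinv_pos (R : numDomainType) n : pos_upto n.+1 (aeinv ('X : {poly R}) n n.+1).
Proof.
apply: pos_uptoD; first exact: einv_pos.
rewrite rpredM ?rpred_nat // rpred_sum // => k _.
rewrite !rpredM ?nneg_geomX ?rpredX ?polyOverX // rpred_prod // => i _.
exact: nneg_geomX.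
Qed.

(** * Reduction modulo X^(n+1) and the dissection of a_n *)

Lemma in_qpolyXn_coef (R : comNzRingType) M (p q : {poly R}) i :
  in_qpoly ('X^(M.+1)) p = in_qpoly ('X^(M.+1)) q -> (i < M.+1)%N -> p`_i = q`_i.
Proof.
move=> /(congr1 val) /= E lt_i.
rewrite mk_monic_Xn /= in E.
rewrite (Pdiv.RingMonic.rdivp_eq (monicXn R M.+1) p).
rewrite (Pdiv.RingMonic.rdivp_eq (monicXn R M.+1) q).
by rewrite E !coefD !coefMXn lt_i.
Qed.

Lemma in_qpolyXn_eq0 (R : comNzRingType) M : in_qpoly ('X^(M.+1)) 'X ^+ M.+1 = 0
  :> {poly %/ ('X^(M.+1) : {poly R})}.
Proof.
rewrite -rmorphXn /=; apply: val_inj => /=.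
by rewrite mk_monic_Xn Pdiv.RingMonic.rmodpp ?monicXn.
Qed.

Lemma coef_Xn_comp (R : comNzRingType) (p : {poly R}) r e n : (0 < e)%N ->
  ('X^r * (p \Po 'X^e))`_n =
  if (r <= n)%N && (e %| n - r)%N then p`_((n - r) %/ e) else 0.
Proof.
move=> e_gt0; rewrite coefXnM coef_comp_poly_Xn //.
by rewrite ltnNge; case: (r <= n)%N.
Qed.

(** The reason for working over [algC]: it contains w and is still a [numDomainType], so signs can
    be read off there. *)
Lemma cube_root_algC : exists w : algC, w ^+ 2 + w + 1 = 0.
Proof.
have [w w_prim] := C_prim_root_exists (isT : 0 < 3)%N.
exists w; have w_neq1 : w - 1 != 0.
  rewrite subr_eq0 -(prim_order_dvd w_prim 1) ?expr1 //.
apply: (mulfI w_neq1); rewrite mulr0.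
have -> : (w - 1) * (w ^+ 2 + w + 1) = w ^+ 3 - 1 by ring.
by rewrite (prim_expr_order w_prim) subrr.
Qed.

Lemma a_algC n : (a n)%:~R =
  (epoch 'X n ^+ 9 * einv 'X^3 n n.+1 ^+ 9)`_n :> algC.
Proof.
rewrite /a -(coef_map intr) rmorphM !rmorphXn /=; congr (nth 0 (polyseq (_ ^+ 9 * _ ^+ 9)) n).
  rewrite /qpoch_q big_add1 big_mkord rmorph_prod; apply: eq_bigr => k _.
  by rewrite rmorphB rmorph1 /= map_polyXn.
rewrite /inv_qpoch_q3 big_add1 big_mkord rmorph_prod; apply: eq_bigr => k _.
rewrite rmorph_sum; apply: eq_bigr => j _ /=.
by rewrite map_polyXn !exprM.
Qed.

(** Turns the dissection into an equality of two images under f, with multiples written [*+] so that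
    coefficients can be taken termwise. *)
Lemma rmorph_dissection (A B : comNzRingType) (f : {rmorphism A -> B})
    (x e g3 g9 h3 h9 w3 w9 : A) :
  f e ^+ 9 * f w3 ^+ 9 = f g9 * f w9 - 3%:R * f x ^+ 3 * f h9 ^+ 3
    - 9%:R * f x * (f g3 ^+ 2 * f h3 ^+ 3 * f w3 ^+ 2)
    + 27%:R * f x ^+ 2 * (f g3 * f h3 ^+ 6 * f w3) ->
  f (e ^+ 9 * w3 ^+ 9) = f (x ^+ 0 * (g9 * w9) - (x ^+ 3 * h9 ^+ 3) *+ 3
    - (x ^+ 1 * (g3 ^+ 2 * h3 ^+ 3 * w3 ^+ 2)) *+ 9
    + (x ^+ 2 * (g3 * h3 ^+ 6 * w3)) *+ 27).
Proof. by move=> E; rewrite rmorphM !rmorphXn E; ring. Qed.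

Lemma a_dissection n :
  let G := aeinv 'X n n.+1 in let H := e3quot 'X n in let W := einv 'X n n.+1 in
  (a n)%:~R = ('X^0 * ((G * W) \Po 'X^9))`_n
    - ('X^3 * ((H ^+ 3) \Po 'X^9))`_n *+ 3
    - ('X^1 * ((G ^+ 2 * H ^+ 3 * W ^+ 2) \Po 'X^3))`_n *+ 9
    + ('X^2 * ((G * H ^+ 6 * W) \Po 'X^3))`_n *+ 27 :> algC.
Proof.
move=> G H W; have [w w0] := cube_root_algC.
rewrite a_algC -!coefMn -!coefB -coefD.
apply: (@in_qpolyXn_coef _ n) => //.
pose f : {rmorphism {poly algC} -> {poly %/ ('X^(n.+1) : {poly algC})}} :=
  in_qpoly ('X^(n.+1)).
rewrite -[LHS]/(f _) -[RHS]/(f _).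
have fw0 : f w%:P ^+ 2 + f w%:P + 1 = 0.
  by rewrite -rmorphXn -(rmorph1 f) -!rmorphD -rmorphXn -!polyCD w0 rmorph0.
pose x := f 'X.
have x0 : x ^+ n.+1 = 0 by exact: in_qpolyXn_eq0.
have fX k : f 'X^k = x ^+ k by exact: rmorphXn.
(* Substitution and reduction are both morphisms, so the class of G(X^k) is [aeinv] at x^k. *)
have fG k : f (G \Po 'X^k) = aeinv (x ^+ k) n n.+1.
  have := rmorph_aeinv (comp_poly ('X^k : {poly algC})) 'X n n.+1.
  by rewrite /= comp_polyX => ->; rewrite -fX; exact: (rmorph_aeinv f).
have fH k : f (H \Po 'X^k) = e3quot (x ^+ k) n.
  have := rmorph_e3quot (comp_poly ('X^k : {poly algC})) 'X n.
  by rewrite /= comp_polyX => ->; rewrite -fX; exact: (rmorph_e3quot f).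
have fW k : f (W \Po 'X^k) = einv (x ^+ k) n n.+1.
  have := rmorph_einv (comp_poly ('X^k : {poly algC})) 'X n n.+1.
  by rewrite /= comp_polyX => ->; rewrite -fX; exact: (rmorph_einv f).
have fE : f (epoch 'X n) = epoch x n by exact: (rmorph_epoch f).
have WE : einv 'X^3 n n.+1 = W \Po 'X^3.
  have := rmorph_einv (comp_poly ('X^3 : {poly algC})) 'X n n.+1.
  by rewrite /= comp_polyX => ->.
have := quotient_dissection fw0 x0.
rewrite /= -fE -!fG -!fH -!fW WE !comp_polyM /x.
move: (epoch _ _) => e.
move: (G \Po _) (G \Po _) (H \Po _) (H \Po _) (W \Po _) (W \Po _).
move=> g3 g9 h3 h9 w9 w3.
rewrite -[in_qpoly _ (e ^+ 9 * w3 ^+ 9)]/(f _).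
exact: rmorph_dissection.
Qed.

Lemma a_pos_dissection n : exists q0 q1 q2 q3 : {poly algC},
  [/\ pos_upto n.+1 q0, pos_upto n.+1 q1, pos_upto n.+1 q2, pos_upto n.+1 q3
    & (a n)%:~R = ('X^0 * (q0 \Po 'X^9))`_n - ('X^3 * (q3 \Po 'X^9))`_n *+ 3
    - ('X^1 * (q1 \Po 'X^3))`_n *+ 9 + ('X^2 * (q2 \Po 'X^3))`_n *+ 27].
Proof.
have Gp := aeinv_pos algC n; have Hp := e3quot_pos algC n; have Wp := einv_pos algC n.
do 4 eexists; split; last exact: a_dissection.
- exact: pos_uptoM.
(* [pos_uptoX k] concerns the power k + 1. *)
- exact: (pos_uptoM (pos_uptoM (pos_uptoX 1 Gp) (pos_uptoX 2 Hp)) (pos_uptoX 1 Wp)).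
- exact: (pos_uptoM (pos_uptoM Gp (pos_uptoX 5 Hp)) Wp).
- exact: (pos_uptoX 2 Hp).
Qed.

Theorem theorem1p3 (n : nat) :
  [/\ ((n %% 9 == 0)%N || (n %% 9 == 2)%N || (n %% 9 == 5)%N || (n %% 9 == 8)%N) ->
        0 < a n,
      ((n %% 9 == 1)%N || (n %% 9 == 3)%N || (n %% 9 == 4)%N || (n %% 9 == 7)%N) ->
        a n < 0
    & (n %% 9 == 6)%N -> a n = 0].
Proof.
have [q0 [q1 [q2 [q3 [[_ p0] [_ p1] [_ p2] [_ p3]]]]]] := a_pos_dissection n.
rewrite !coef_Xn_comp // => aE.
have lt_div k d : ((n - k) %/ d < n.+1)%N.
  by rewrite ltnS (leq_trans (leq_div _ _)) // leq_subr.
(* The series of [q0], [q3], [q1], [q2] are supported on n = 0 mod 9, 3 mod 9, 1 mod 3 and 2 mod 3: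
   disjoint classes that miss exactly 6 mod 9. So at most one term survives, and its sign
   decides. *)
split=> res.
- rewrite -(ltr0z algC) aE [(3 <= n)%N && _](_ : _ = false); last by lia.
  rewrite [(1 <= n)%N && _](_ : _ = false); last by lia.
  rewrite !mul0rn !subr0.
  have [n0|n0] := boolP (n %% 9 == 0)%N.
    rewrite ifT; last by lia.
    by rewrite ifF ?mul0rn ?addr0 ?p0 //; lia.
  rewrite ifF; last by lia.
  by rewrite ifT ?add0r ?pmulrn_lgt0 ?p2 //; lia.
- rewrite -(ltrz0 algC) aE [(0 <= n)%N && _](_ : _ = false); last by lia.
  rewrite [(2 <= n)%N && _](_ : _ = false); last by lia.
  rewrite mul0rn addr0 sub0r -opprD oppr_lt0.
  have [n3|n3] := boolP (n %% 9 == 3)%N.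
    rewrite ifT; last by lia.
    by rewrite ifF ?mul0rn ?addr0 ?pmulrn_lgt0 ?p3 //; lia.
  rewrite ifF; last by lia.
  by rewrite ifT ?mul0rn ?add0r ?pmulrn_lgt0 ?p1 //; lia.
apply/eqP; rewrite -(intr_eq0 algC) aE !ifF ?mul0rn ?subrr ?addr0 ?subr0 //; lia.
Qed.
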